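(* Let $C_1$ and $C_2$ be distinct nonsingular cubic curves in $\mathbb{P}^2$, and let $P\in C_1\cap C_2$. Let $\pi_P$ be the projection from $P$, and let $R_i$ ($i=1,2$) be the set of ramification points of $\pi_P|_{C_i}:C_i\to\mathbb{P}^1$. If $P\in S\Delta^1_{\mathrm{in}}(C_1,C_2)$, then $\pi_P(R_1\setminus\{P\})=\pi_P(R_2\setminus\{P\})$.
   Context: $k$ is an algebraically closed field of characteristic $0$; all curves are over $k$. For $P\in\mathbb{P}^2$, $\pi_P$ denotes the projection from $P$ to $\mathbb{P}^1$; its restriction $\pi_P|_{C_i}$ to a nonsingular curve $C_i$ is regarded as a morphism on all of $C_i$ (extended over $P$ if $P\in C_i$), and $\pi_P^*k(\mathbb{P}^1)\subset k(C_i)$ is the resulting subfield. For distinct nonsingular cubics $C_1,C_2$ (so that $C_1\cup C_2$ is reduced), a point $P\in\mathbb{P}^2$ is a simultaneous Galois point (SG point) for $C_1\cup C_2$ if each extension $k(C_i)/\pi_P^*k(\mathbb{P}^1)$ ($i=1,2$) is Galois and $k(C_1)\simeq k(C_2)$ as $\pi_P^*k(\mathbb{P}^1)$-algebras (i.e. as extensions of $k(\mathbb{P}^1)$ via $\pi_P^*$). It is inner if $P\in C_1\cap C_2$; $S\Delta_{\mathrm{in}}(C_1,C_2)$ is the set of inner SG points. $P$ is an SG point of the first kind for $C_1\cup C_2$ if there exists a birational map $\phi:C_1\to C_2$ such that (i) $\pi_P\circ\phi=\pi_P$ and (ii) $\phi$ extends to a projective transformation of $\mathbb{P}^2$; the set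 of these is $S\Delta^1(C_1,C_2)$. Finally $S\Delta^1_{\mathrm{in}}(C_1,C_2):=S\Delta_{\mathrm{in}}(C_1,C_2)\cap S\Delta^1(C_1,C_2)$. *)

(* Defs.v *)
From HB Require Import structures.
From mathcomp Require Import all_boot all_order all_algebra all_field.
From mathcomp Require Import generic_quotient ring_quotient fraction.
From mathcomp Require Import mpoly ring.
From mathcomp Require Import boolp classical_sets.

Set Implicit Arguments.
Unset Strict Implicit.
Unset Printing Implicit Defensive.

Import GRing.Theory.

Local Open Scope ring_scope.
Local Open Scope quotient_scope.
Local Open Scope classical_set_scope.

Local Notation "x %:F" := (@FracField.tofrac _ x).

(* Points of P^n are the lines of k^(n+1), so that Leibniz equality is equality
   of points. *)
Definition pspace (k : fieldType) (n : nat) : Type :=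
  {U : {vspace 'rV[k]_n.+1} | \dim U == 1%N}.

Section Forms.
Variables (k : fieldType) (n : nat).

Definition hcoord (Q : pspace k n) : 'rV[k]_n.+1 := vpick (val Q).

Definition feval (v : 'rV[k]_n.+1) (f : {mpoly k[n.+1]}) : k :=
  f.@[fun i => v 0 i].

Definition fvanish (f : {mpoly k[n.+1]}) (Q : pspace k n) : Prop :=
  feval (hcoord Q) f = 0.

Definition mdvd (F p : {mpoly k[n.+1]}) : Prop := exists q, p = q * F.

(* f / g has degree 0 *)
Definition same_deg (f g : {mpoly k[n.+1]}) : Prop :=
  exists d : nat, f \is d.-homog /\ g \is d.-homog.

Lemma same_degM f g f' g' :
  same_deg f g -> same_deg f' g' -> same_deg (f * f') (g * g').
Proof.
by case=> d [fd gd] [d' [fd' gd']]; exists (d + d')%N; split; exact: dhomogM.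
Qed.

Lemma same_degB f g f' g' : same_deg f g -> same_deg f' g' ->
  same_deg (f * g' - f' * g) (g * g').
Proof.
case=> d [fd gd] [d' [fd' gd']]; exists (d + d')%N; split; last exact: dhomogM.
by apply: rpredB; [exact: dhomogM | rewrite addnC; exact: dhomogM].
Qed.

Lemma same_deg1 : same_deg 1 1.
Proof. by exists 0%N; split; exact: dhomog1. Qed.

End Forms.

Lemma fracB (R : idomainType) (f g f' g' : R) : g != 0 -> g' != 0 ->
  f%:F / g%:F - f'%:F / g'%:F = (f * g' - f' * g)%:F / (g * g')%:F.
Proof.
by move=> g0 g'0; rewrite -mulNr addf_div ?tofrac_eq0 // rmorphB !rmorphM mulNr.
Qed.

Lemma fracM (R : idomainType) (f g f' g' : R) :
  (f%:F / g%:F) * (f'%:F / g'%:F) = (f * f')%:F / (g * g')%:F.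
Proof. by rewrite mulf_div !rmorphM. Qed.

Record subfld (E : fieldType) (P : divringClosed E) :=
  SubFld { subfld_val :> E; _ : subfld_val \in P }.
Section SubFld.
Variables (E : fieldType) (P : divringClosed E).
HB.instance Definition _ := [isSub for @subfld_val E P].
HB.instance Definition _ := [Choice of subfld P by <:].
HB.instance Definition _ := [SubChoice_isSubIntegralDomain of subfld P by <:].
HB.instance Definition _ := [SubIntegralDomain_isSubField of subfld P by <:].
End SubFld.

Record subrng (E : comNzRingType) (P : subringClosed E) :=
  SubRng { subrng_val :> E; _ : subrng_val \in P }.
Section SubRng.
Variables (E : comNzRingType) (P : subringClosed E).
HB.instance Definition _ := [isSub for @subrng_val E P].
HB.instance Definition _ := [Choice of subrng P by <:].
HB.instance Definition _ := [SubChoice_isSubComNzRing of subrng P by <:].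
End SubRng.

Lemma fracD (R : idomainType) (f g f' g' : R) : g != 0 -> g' != 0 ->
  f%:F / g%:F + f'%:F / g'%:F = (f * g' + f' * g)%:F / (g * g')%:F.
Proof. by move=> g0 g'0; rewrite addf_div ?tofrac_eq0 // rmorphD !rmorphM. Qed.

Section ProjFunctionField.
Variables (k : fieldType) (n : nat).
Implicit Types (f g : {mpoly k[n.+1]}) (u : {fraction {mpoly k[n.+1]}}).

Definition pfun_pred : {pred {fraction {mpoly k[n.+1]}}} :=
  fun u => `[< exists f g, [/\ same_deg f g, g != 0 & u = f%:F / g%:F] >].

Lemma pfun_divring : divring_closed pfun_pred.
Proof.
split.
- apply/asboolP; exists 1, 1; split; [exact: same_deg1 | exact: oner_neq0 |].
  by rewrite rmorph1 divr1.
- move=> u v /asboolP[f [g [fg g0 ->]]] /asboolP[f' [g' [fg' g'0 ->]]].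
  apply/asboolP; exists (f * g' - f' * g), (g * g'); split.
  + exact: same_degB.
  + exact: mulf_neq0.
  + exact: fracB.
- move=> u v /asboolP[f [g [fg g0 ->]]] /asboolP[f' [g' [fg' g'0 ->]]].
  apply/asboolP; have [f'0|f'0] := eqVneq f' 0.
    exists 0, 1; split; last by rewrite f'0 rmorph0 !mul0r invr0 mulr0.
      by exists 0%N; split; [exact: rpred0 | exact: dhomog1].
    exact: oner_neq0.
  exists (f * g'), (g * f'); split; last by rewrite invf_div fracM.
    by case: fg' => d [? ?]; apply: same_degM => //; exists d.
  exact: mulf_neq0.
Qed.

HB.instance Definition _ :=
  GRing.isDivringClosed.Build _ pfun_pred pfun_divring.

(* k(P^n): the subfield of degree 0 elements of k(X_0, ..., X_n) *)
Definition pfun : Type :=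
  subfld (GRing.DivringClosed.clone _ pfun_pred _).
HB.instance Definition _ := GRing.Field.on pfun.
HB.instance Definition _ := SubChoice.on pfun.

Definition pfun_rep (u : pfun) : {mpoly k[n.+1]} * {mpoly k[n.+1]} :=
  xget (0, 1) [set fg | [/\ same_deg fg.1 fg.2, fg.2 != 0 &
                            val u = fg.1%:F / fg.2%:F]].

Definition ploc (y : pspace k n) : set pfun :=
  [set u | exists f g, [/\ same_deg f g, ~ fvanish g y &
                           val u = f%:F / g%:F]].

Definition pmax (y : pspace k n) : set pfun :=
  [set u | exists f g, [/\ same_deg f g, ~ fvanish g y, fvanish f y &
                           val u = f%:F / g%:F]].

End ProjFunctionField.

Definition mpcomp (k : fieldType) (m n : nat) (G : 'rV[{mpoly k[m]}]_n)
    (f : {mpoly k[n]}) : {mpoly k[m]} :=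
  f \mPo [tuple G 0 i | i < n].

Record cubic (k : fieldType) := Cubic {
  cubic_form :> {mpoly k[3]};
  cubic_homog : cubic_form \is 3.-homog;
  cubic_neq0 : cubic_form != 0 }.

Section Curves.
Variable k : fieldType.
Implicit Types (C : cubic k) (P Q : pspace k 2) (f g : {mpoly k[3]}).

Definition cpoints C : set (pspace k 2) := [set Q | fvanish C Q].

Definition nonsingular C : Prop :=
  forall Q, cpoints C Q -> exists i : 'I_3, ~ fvanish (C^`M(i)) Q.

Lemma cubic_not_unit C : ~ mdvd C 1.
Proof.
have C0 : C@_0%MM = 0.
  by apply: (dhomog_nemf_coeff (cubic_homog C)); rewrite mf0.
case=> q /(congr1 (mcoeff 0%MM)) /eqP.
by rewrite rmorph1 rmorphM /= C0 mulr0 oner_eq0.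
Qed.

(* f is a nonzerodivisor modulo the equation of C. Since a nonsingular C is
   irreducible, this then just says that f does not vanish identically on C. *)
Definition regular_on C f : Prop := forall h, mdvd C (f * h) -> mdvd C h.

Lemma regular1 C : regular_on C 1.
Proof. by move=> h; rewrite mul1r. Qed.

Lemma regularM C f g : regular_on C f -> regular_on C g -> regular_on C (f * g).
Proof. by move=> rf rg h; rewrite -mulrA => /rf /rg. Qed.

Lemma regular_neq0 C f : regular_on C f -> f != 0.
Proof.
move=> rf; apply/eqP => f0; apply: (@cubic_not_unit C).
by apply: rf; rewrite f0 mul0r; exists 0; rewrite mul0r.
Qed.

End Curves.

Section CurveFunctionField.
Variables (k : fieldType) (C : cubic k).
Local Notation S := {mpoly k[3]}.

(* The local ring of P^2 at the generic point of C *)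
Definition gen_pred : {pred {fraction S}} := fun u =>
  `[< exists f g, [/\ same_deg f g, regular_on C g & u = f%:F / g%:F] >].

Lemma gen_subring : subring_closed gen_pred.
Proof.
split.
- apply/asboolP; exists 1, 1; split; [exact: same_deg1 | exact: regular1 |].
  by rewrite rmorph1 divr1.
- move=> u v /asboolP[f [g [fg rg ->]]] /asboolP[f' [g' [fg' rg' ->]]].
  apply/asboolP; exists (f * g' - f' * g), (g * g'); split.
  + exact: same_degB.
  + exact: regularM.
  + exact: fracB (regular_neq0 rg) (regular_neq0 rg').
- move=> u v /asboolP[f [g [fg rg ->]]] /asboolP[f' [g' [fg' rg' ->]]].
  apply/asboolP; exists (f * f'), (g * g'); split.
  + exact: same_degM.
  + exact: regularM.
  + exact: fracM.
Qed.

HB.instance Definition _ :=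
  GRing.isSubringClosed.Build _ gen_pred gen_subring.

Definition gen_ring : Type := subrng (GRing.SubringClosed.clone _ gen_pred _).
HB.instance Definition _ := GRing.ComNzRing.on gen_ring.
HB.instance Definition _ := SubChoice.on gen_ring.

Definition gen_ideal_pred : {pred gen_ring} := fun u =>
  `[< exists f g, [/\ same_deg f g, regular_on C g, mdvd C f
                     & val u = f%:F / g%:F] >].

Lemma gen_ideal_closed : idealr_closed gen_ideal_pred.
Proof.
split.
- apply/asboolP; exists 0, 1; split.
  + by exists 0%N; split; [exact: rpred0 | exact: dhomog1].
  + exact: regular1.
  + by exists 0; rewrite mul0r.
  + by rewrite rmorph0 rmorph0 mul0r.
- apply/asboolP => -[f [g [_ rg Cf /= fg]]]; apply: (@cubic_not_unit _ C).
  apply: (rg); rewrite mulr1; suff <- : f = g by [].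
  have g0 : g%:F != 0 by rewrite tofrac_eq0 (regular_neq0 rg).
  by apply/eqP; rewrite -tofrac_eq -[f%:F](divfK g0) -fg mul1r.
- move=> [a /= aP] u v /asboolP[f [g [fg rg [q qf] uE]]].
  case/asboolP=> f' [g' [fg' rg' [q' qf'] vE]].
  case/asboolP: (aP) => f1 [g1 [fg1 rg1 aE]].
  apply/asboolP; exists (f1 * f * g' + f' * (g1 * g)), (g1 * g * g'); split.
  + case: fg fg' fg1 => [d [fd gd]] [d' [fd' gd']] [d1 [fd1 gd1]].
    exists (d1 + d + d')%N; split; last by do 2!apply: dhomogM => //.
    apply: rpredD; first by do 2!apply: dhomogM => //.
    by rewrite addnC; do 2!apply: dhomogM => //.
  + by do 2!apply: regularM => //.
  + by exists (f1 * q * g' + q' * (g1 * g)); rewrite qf qf'; ring.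
  + rewrite rmorphD rmorphM /= uE vE aE fracM.
    apply: fracD; last exact: regular_neq0 rg'.
    exact: mulf_neq0 (regular_neq0 rg1) (regular_neq0 rg).
Qed.

HB.instance Definition _ :=
  isIdealr.Build gen_ring gen_ideal_pred gen_ideal_closed.

(* k(C), as the residue ring of that local ring; a field when C is irreducible,
   in particular when C is nonsingular *)
Definition cfun : Type := {ideal_quot (Idealr.clone _ gen_ideal_pred _)}.
HB.instance Definition _ := GRing.ComNzRing.on cfun.

(* The restriction of f / g to C; only meaningful for f, g of the same degree
   with g regular on C. *)
Definition cratio (f g : S) : cfun := \pi_cfun (insubd 0 (f%:F / g%:F)).

End CurveFunctionField.

(* The n-th power of the ideal m of the subring O of K. *)
Fixpoint ideal_pow (K : comNzRingType) (O m : set K) (n : nat) : set K :=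
  if n is n'.+1 then
    [set h | exists r : seq (K * K),
       (forall ab, ab \in r -> m ab.1 /\ ideal_pow O m n' ab.2) /\
       h = \sum_(ab <- r) ab.1 * ab.2]
  else O.

Section Points.
Variable k : fieldType.
Implicit Types (C : cubic k) (Q : pspace k 2) (y : pspace k 1).

Definition cloc C Q : set (cfun C) :=
  [set h | exists f g, [/\ same_deg f g, ~ fvanish g Q & h = cratio C f g]].

Definition cmax C Q : set (cfun C) :=
  [set h | exists f g, [/\ same_deg f g, ~ fvanish g Q, fvanish f Q &
                           h = cratio C f g]].

(* v_Q(h) = e for the discrete valuation v_Q of the local ring of C at Q *)
Definition cval C Q (h : cfun C) (e : nat) : Prop :=
  ideal_pow (@cloc C Q) (@cmax C Q) e h /\
  ~ ideal_pow (@cloc C Q) (@cmax C Q) e.+1 h.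

Definition local_param y (t : pfun k 1) : Prop :=
  pmax y t /\ ~ ideal_pow (ploc y) (pmax y) 2 t.

End Points.

(* A rational map from C to P^n is given by a row of n+1 forms of the same
   degree, not all identically zero on C. As in the definition of cfun,
   "not identically zero" is spelled regular_on, which amounts to ~ mdvd C _
   when C is irreducible. *)
Section RationalMaps.
Variable k : fieldType.
Implicit Types (C : cubic k) (Q : pspace k 2).

Definition is_ratmap C n (G : 'rV[{mpoly k[3]}]_n.+1) : Prop :=
  (exists d : nat, forall i, G 0 i \is d.-homog) /\
  (exists i, regular_on C (G 0 i)).

Definition ratmap_eq C n (G H : 'rV[{mpoly k[3]}]_n.+1) : Prop :=
  forall i j, mdvd C (G 0 i * H 0 j - G 0 j * H 0 i).

Definition ratmap_comp n (H : 'rV[{mpoly k[3]}]_n.+1) (G : 'rV[{mpoly k[3]}]_3)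
  : 'rV[{mpoly k[3]}]_n.+1 := map_mx (mpcomp G) H.

(* The (regular) value at Q of the rational map G is y: some representative of
   G does not vanish at Q, and takes the value y there. *)
Definition ratmap_value C n (G : 'rV[{mpoly k[3]}]_n.+1) Q (y : pspace k n)
  : Prop :=
  exists H, [/\ is_ratmap C H, ratmap_eq C G H &
                val y = <[map_mx (feval (hcoord Q)) H]>%VS].

Definition idmap : 'rV[{mpoly k[3]}]_3 := \row_i 'X_i.

(* The linear map [x] |-> [x A] *)
Definition linmap n (A : 'M[k]_(3, n)) : 'rV[{mpoly k[3]}]_n :=
  idmap *m map_mx (@mpolyC 3 k) A.

Definition ratmap_into C1 C2 (G : 'rV[{mpoly k[3]}]_3) : Prop :=
  is_ratmap C1 G /\ mdvd C1 (mpcomp G C2).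

Definition birational C1 C2 (G : 'rV[{mpoly k[3]}]_3) : Prop :=
  ratmap_into C1 C2 G /\
  exists H, [/\ ratmap_into C2 C1 H,
    is_ratmap C1 (ratmap_comp H G), ratmap_eq C1 (ratmap_comp H G) idmap,
    is_ratmap C2 (ratmap_comp G H) & ratmap_eq C2 (ratmap_comp G H) idmap].

(* G^* : k(P^1) -> k(C), for a nonconstant rational map G from C to P^1; the
   representative of u = f / g is irrelevant when C is irreducible, since then
   g(G) is regular on C. *)
Definition pullback C (G : 'rV[{mpoly k[3]}]_2) (u : pfun k 1) : cfun C :=
  let fg := pfun_rep u in cratio C (mpcomp G fg.1) (mpcomp G fg.2).

(* The ramification points of the morphism C -> P^1 extending G *)
Definition ram_points C (G : 'rV[{mpoly k[3]}]_2) : set (pspace k 2) :=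
  [set Q | cpoints C Q /\ exists y t e,
     [/\ ratmap_value C G Q y, local_param y t,
         cval Q (pullback C G t) e & (1 < e)%N]].

Definition ratmap_image C n (G : 'rV[{mpoly k[3]}]_n.+1)
    (R : set (pspace k 2)) : set (pspace k n) :=
  [set y | exists2 Q, R Q & ratmap_value C G Q y].

End RationalMaps.

Section GaloisPoints.
Variable k : fieldType.
Implicit Types (C : cubic k) (P : pspace k 2).

(* [x] |-> [x M] is the projection from P, in some coordinates of P^1 *)
Definition projection_from P (M : 'M[k]_(3, 2)) : Prop :=
  forall v : 'rV[k]_3, (v *m M == 0) = (v \in val P).

(* k(C) is a Galois extension of G^* k(P^1) *)
Definition galois_over C (G : 'rV[{mpoly k[3]}]_2) : Prop :=
  exists (L : splittingFieldType (pfun k 1)) (f : {rmorphism L -> cfun C}),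
    [/\ bijective f, forall u : pfun k 1, f u%:A = pullback C G u
      & galois 1%VS {:L}%VS].

Definition iso_over C1 C2 (G : 'rV[{mpoly k[3]}]_2) : Prop :=
  exists f : {rmorphism cfun C1 -> cfun C2},
    bijective f /\ forall u, f (pullback C1 G u) = pullback C2 G u.

Definition SG_points C1 C2 : set (pspace k 2) :=
  [set P | exists M, [/\ projection_from P M, galois_over C1 (linmap M),
                         galois_over C2 (linmap M) & iso_over C1 C2 (linmap M)]].

Definition SG_in C1 C2 : set (pspace k 2) :=
  SG_points C1 C2 `&` (cpoints C1 `&` cpoints C2).

(* SG points of the first kind *)
Definition SG1 C1 C2 : set (pspace k 2) :=
  [set P | exists M phi,
     [/\ projection_from P M, birational C1 C2 phi,
         is_ratmap C1 (ratmap_comp (linmap M) phi),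
         ratmap_eq C1 (ratmap_comp (linmap M) phi) (linmap M)
       & exists2 A, A \in unitmx & ratmap_eq C1 phi (linmap A)]].

Definition SG1_in C1 C2 : set (pspace k 2) := SG_in C1 C2 `&` SG1 C1 C2.

End GaloisPoints.

(* Main.v *)
(* The projective transformation A of the definition of SG1 satisfies
   A M = s M: the quadratic form (x A M) /\ (x M) vanishes on the cubic C1, hence
   identically. Rescaling A, we get A M = M, so that x |-> x A carries C1 to C2,
   commutes with the projection and fixes its center P; it therefore maps R_1
   onto R_2 and R_1 minus P onto R_2 minus P, compatibly with the projection. *)
Require Import Defs.
From HB Require Import structures.
From mathcomp Require Import all_boot all_order all_algebra all_field.
From mathcomp Require Import generic_quotient ring_quotient fraction.
From mathcomp Require Import mpoly ring.
From mathcomp Require Import boolp classical_sets.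

Import GRing.Theory.

Local Open Scope ring_scope.
Local Open Scope quotient_scope.
Local Open Scope classical_set_scope.

Local Notation "x %:F" := (@FracField.tofrac _ x).

Set Implicit Arguments.
Unset Strict Implicit.
Unset Printing Implicit Defensive.

(** * Substitution into polynomials and linear changes of coordinates *)

Section Substitution.
Variable k : fieldType.

HB.instance Definition _ m n (G : 'rV[{mpoly k[m]}]_n) :=
  GRing.RMorphism.copy (mpcomp G) (comp_mpoly [tuple G 0 i | i < n]).
HB.instance Definition _ m n (G : 'rV[{mpoly k[m]}]_n) :=
  GRing.Linear.copy (mpcomp G) (comp_mpoly [tuple G 0 i | i < n]).

Lemma mpcompE m n (G : 'rV[{mpoly k[m]}]_n) f :
  mpcomp G f = \sum_(mm <- msupp f) f@_mm *: \prod_(i < n) (G 0 i) ^+ mm i.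
Proof.
rewrite /mpcomp comp_mpolyE; apply: eq_bigr => mm _; congr (_ *: _).
by apply: eq_bigr => i _; rewrite tnth_mktuple.
Qed.

Lemma mpcompX m n (G : 'rV[{mpoly k[m]}]_n) i : mpcomp G 'X_i = G 0 i.
Proof. by rewrite /mpcomp comp_mpolyXU -tnth_nth tnth_mktuple. Qed.

Lemma mpcompA m n p (G : 'rV[{mpoly k[m]}]_n) (H : 'rV[{mpoly k[n]}]_p) f :
  mpcomp G (mpcomp H f) = mpcomp (map_mx (mpcomp G) H) f.
Proof.
rewrite (mpcompE H) (mpcompE (map_mx _ _)) rmorph_sum /=.
apply: eq_bigr => mm _; rewrite linearZ /= rmorph_prod /=; congr (_ *: _).
by apply: eq_bigr => i _; rewrite mxE rmorphXn.
Qed.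

Lemma mpcomp_idmap f : mpcomp (idmap k) f = f.
Proof.
rewrite -[RHS]comp_mpoly_id /mpcomp; congr comp_mpoly.
by apply: eq_mktuple => i; rewrite mxE.
Qed.

Lemma mpcomp_homog m n d e (G : 'rV[{mpoly k[m]}]_n) f :
  (forall i, G 0 i \is d.-homog) -> f \is e.-homog ->
  mpcomp G f \is (d * e).-homog.
Proof.
move=> Gd /dhomogP fe; rewrite mpcompE big_seq; apply: rpred_sum => mm /fe <-.
apply: rpredZ; rewrite /= mdegE big_distrr /=.
elim/big_rec2: _ => [|i p e' _ he]; first exact: dhomog1.
by apply: dhomogM => //; apply: dhomogMn.
Qed.

Lemma eq_mmap (S : comNzRingType) (h : k -> S) n (u v : 'I_n -> S)
    (f : {mpoly k[n]}) : u =1 v -> mmap h u f = mmap h v f.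
Proof.
by move=> uv; apply: eq_bigr => mm _; rewrite (mmap1_eq _ uv).
Qed.

(** Working in a general target ring covers both uses: polynomial factors in [mpcomp_scale] and
    scalar factors in [feval_scale]. *)
Lemma mmap_scale (S : comNzRingType) (h : {rmorphism k -> S}) n d
    (u : 'I_n -> S) s (f : {mpoly k[n]}) :
  f \is d.-homog -> mmap h (fun i => s * u i) f = s ^+ d * mmap h u f.
Proof.
move=> /dhomogP fd; rewrite /mmap mulr_sumr big_seq [RHS]big_seq.
apply: eq_bigr => mm /fd <-; rewrite mulrCA; congr (_ * _).
rewrite /mmap1 /= mdegE -prodrXr -big_split /=.
by apply: eq_bigr => i _; rewrite exprMn.
Qed.

Lemma mpcomp_scale m n d (p : {mpoly k[m]}) (G : 'rV[{mpoly k[m]}]_n) f :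
  f \is d.-homog -> mpcomp (p *: G) f = p ^+ d * mpcomp G f.
Proof.
move=> /(mmap_scale (@mpolyC m k) (tnth [tuple G 0 i | i < n]) p) <-.
by apply: eq_mmap => i; rewrite !tnth_mktuple mxE.
Qed.

Lemma feval_scale n d s (v : 'rV[k]_n.+1) f :
  f \is d.-homog -> feval (s *: v) f = s ^+ d * feval v f.
Proof.
move=> /(mmap_scale (idfun : {rmorphism k -> k}) (v 0) s) <-.
by apply: eq_mmap => i; rewrite mxE.
Qed.

Lemma mpcomp_linmap m n (G : 'rV[{mpoly k[m]}]_3) (B : 'M[k]_(3, n)) :
  map_mx (mpcomp G) (linmap B) = G *m map_mx (@mpolyC m k) B.
Proof.
apply/rowP => j; rewrite !mxE rmorph_sum; apply: eq_bigr => i _.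
by rewrite !mxE rmorphM /= mpcompX /mpcomp comp_mpolyC.
Qed.

Lemma linmap_comp n (A : 'M[k]_3) (B : 'M[k]_(3, n)) :
  map_mx (mpcomp (linmap A)) (linmap B) = linmap (A *m B).
Proof. by rewrite mpcomp_linmap /linmap map_mxM mulmxA. Qed.

Lemma linmap1 : linmap 1%:M = idmap k.
Proof. by rewrite /linmap map_scalar_mx rmorph1 mulmx1. Qed.

Lemma linmap_scale n s (B : 'M[k]_(3, n)) :
  linmap (s *: B) = s%:MP *: linmap B.
Proof. by rewrite /linmap map_mxZ scalemxAr. Qed.

Lemma linmap_homog n (B : 'M[k]_(3, n)) i : linmap B 0 i \is 1.-homog.
Proof.
rewrite mxE; apply: rpred_sum => j _; rewrite !mxE mulrC mul_mpolyC.
by apply: rpredZ; rewrite dhomogX /= mdeg1.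
Qed.

Lemma feval_linmap n (v : 'rV[k]_3) (B : 'M[k]_(3, n)) :
  map_mx (feval v) (linmap B) = v *m B.
Proof.
apply/rowP => j; rewrite !mxE /feval rmorph_sum; apply: eq_bigr => i _.
by rewrite !mxE rmorphM /= mevalXU mevalC.
Qed.

Lemma feval_mpcomp m n (v : 'rV[k]_m.+1) (G : 'rV[{mpoly k[m.+1]}]_n.+1) f :
  feval v (mpcomp G f) = feval (map_mx (feval v) G) f.
Proof.
rewrite /feval comp_mpoly_meval; apply: eq_mmap => i.
by rewrite tnth_mktuple !mxE.
Qed.

Definition subst (A : 'M[k]_3) : {mpoly k[3]} -> {mpoly k[3]} :=
  mpcomp (linmap A).

HB.instance Definition _ A :=
  GRing.RMorphism.copy (subst A) (mpcomp (linmap A)).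
HB.instance Definition _ A := GRing.Linear.copy (subst A) (mpcomp (linmap A)).

Lemma subst_comp A B f : subst A (subst B f) = subst (A *m B) f.
Proof. by rewrite /subst mpcompA linmap_comp. Qed.

Lemma subst1 f : subst 1%:M f = f.
Proof. by rewrite /subst linmap1 mpcomp_idmap. Qed.

Lemma substK A : A \in unitmx -> cancel (subst A) (subst (invmx A)).
Proof. by move=> Au f; rewrite subst_comp mulVmx // subst1. Qed.

Lemma substVK A : A \in unitmx -> cancel (subst (invmx A)) (subst A).
Proof. by move=> Au f; rewrite subst_comp mulmxV // subst1. Qed.

Lemma subst_eq0 A f : A \in unitmx -> (subst A f == 0) = (f == 0).
Proof. by move=> Au; apply: raddf_eq0; apply: can_inj (substK Au). Qed.

Lemma subst_homog A d f : f \is d.-homog -> subst A f \is d.-homog.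
Proof.
move=> fd; rewrite -[d]mul1n; apply: mpcomp_homog fd => i.
exact: linmap_homog.
Qed.

Lemma subst_same_deg A f g : same_deg f g -> same_deg (subst A f) (subst A g).
Proof. by case=> d [? ?]; exists d; split; apply: subst_homog. Qed.

Lemma feval_subst (v : 'rV[k]_3) A f : feval v (subst A f) = feval (v *m A) f.
Proof. by rewrite /subst feval_mpcomp feval_linmap. Qed.

End Substitution.

(** * Divisibility by the equation of a cubic, and its function field *)

Section Equation.
Variables (k : fieldType) (C : cubic k).
Implicit Types f g h : {mpoly k[3]}.

Lemma mdvd0 : mdvd C 0.
Proof. by exists 0; rewrite mul0r. Qed.

Lemma mdvdD f g : mdvd C f -> mdvd C g -> mdvd C (f + g).
Proof. by case=> p -> [q ->]; exists (p + q); rewrite mulrDl. Qed.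

Lemma mdvdMl f g : mdvd C g -> mdvd C (f * g).
Proof. by case=> q ->; exists (f * q); rewrite mulrA. Qed.

Lemma mdvdB f g : mdvd C f -> mdvd C g -> mdvd C (f - g).
Proof. by move=> hf hg; rewrite -mulN1r; apply/mdvdD/mdvdMl. Qed.

(** Congruence modulo [C] respects sums and products, hence polynomial expressions. *)
Lemma mdvd_mpcomp n (G H : 'rV[{mpoly k[3]}]_n) (f : {mpoly k[n]}) :
  (forall i, mdvd C (G 0 i - H 0 i)) -> mdvd C (mpcomp G f - mpcomp H f).
Proof.
move=> GH; have congM a b c d :
    mdvd C (a - b) -> mdvd C (c - d) -> mdvd C (a * c - b * d).
  move=> ab cd; rewrite (_ : _ - _ = c * (a - b) + b * (c - d)); last by ring.
  by apply/mdvdD; apply: mdvdMl.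
have cong0 (a : {mpoly k[3]}) : mdvd C (a - a) by rewrite subrr; apply: mdvd0.
rewrite !mpcompE; elim/big_rec2: _ => // mm p q _ pq.
rewrite opprD addrACA; apply: mdvdD => //.
rewrite -scalerBr -mul_mpolyC; apply: mdvdMl.
elim/big_rec2: _ => // i p' q' _; apply: (congM).
by elim: (mm i) => [|e IH]; rewrite ?expr0 // !exprS; apply: (congM).
Qed.

Lemma homog_msize n d (f : {mpoly k[n]}) :
  f \is d.-homog -> f != 0 -> msize f = d.+1.
Proof. by move=> /dhomogP fd f0; rewrite -(mlead_deg f0) fd // mlead_supp. Qed.

Lemma mdvd_small d f : f \is d.-homog -> (d < 3)%N -> mdvd C f -> f = 0.
Proof.
move=> fd d3 [q fE]; apply/eqP/contraT => f0; have := f0.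
rewrite {1}fE mulf_eq0 negb_or => /andP[q0 C0].
have := homog_msize fd f0; rewrite fE msizeM // (homog_msize (cubic_homog C)) //.
(* [msize] is the degree plus one, so [e] reads [msize q + 3 = d + 1]; as [d < 3], this forces
   [q = 0]. *)
rewrite addnS /= => e; move: d3; rewrite -e -[leqRHS]addn0 addnC leq_add2l leqn0.
by rewrite msize_poly_eq0 (negbTE q0).
Qed.

Lemma mdvd_cubic f : f \is 3.-homog -> f != 0 -> mdvd C f ->
  exists2 c, c != 0 & f = c *: (C : {mpoly k[3]}).
Proof.
move=> fd f0 [q fE]; have := f0.
rewrite {1}fE mulf_eq0 negb_or => /andP[q0 C0].
have := homog_msize fd f0; rewrite fE msizeM // (homog_msize (cubic_homog C)) //.
(* Here the sizes give [msize q = 1], so the cofactor is a nonzero constant. *)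
rewrite addnS /= -[RHS](add1n 3) => /addIn/eqP/msize_poly1P[c c0 ->].
by exists c => //; rewrite mul_mpolyC.
Qed.

Definition good f g := same_deg f g /\ regular_on C g.

Lemma gen_ratio f g : good f g -> (f%:F / g%:F) \in @gen_pred k C.
Proof. by case=> fg rg; apply/asboolP; exists f, g. Qed.

Lemma val_ratio f g : good f g ->
  val (insubd (0 : gen_ring C) (f%:F / g%:F)) = f%:F / g%:F.
Proof. by move=> fg; rewrite insubdK //; apply: gen_ratio. Qed.

Lemma goodD f g f' g' : good f g -> good f' g' ->
  good (f * g' + f' * g) (g * g').
Proof.
move=> [fg rg] [fg' rg']; split; last exact: regularM.
rewrite -[f']opprK mulNr; apply: same_degB => //.
by case: fg' => d [? ?]; exists d; rewrite rpredN.
Qed.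

Lemma goodM f g f' g' : good f g -> good f' g' -> good (f * f') (g * g').
Proof. by move=> [? ?] [? ?]; split; [exact: same_degM | exact: regularM]. Qed.

Lemma cratioD f g f' g' : good f g -> good f' g' ->
  cratio C f g + cratio C f' g' = cratio C (f * g' + f' * g) (g * g').
Proof.
move=> h h'; rewrite /cratio -rmorphD; congr (\pi _); apply: val_inj.
rewrite rmorphD /= !val_ratio //; last exact: goodD.
by apply: fracD; [apply: regular_neq0 h.2 | apply: regular_neq0 h'.2].
Qed.

Lemma cratioM f g f' g' : good f g -> good f' g' ->
  cratio C f g * cratio C f' g' = cratio C (f * f') (g * g').
Proof.
move=> h h'; rewrite /cratio -rmorphM; congr (\pi _); apply: val_inj.
by rewrite rmorphM /= !val_ratio ?fracM //; apply: goodM.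
Qed.

Lemma cratio_eqP f g f' g' : good f g -> good f' g' ->
  cratio C f g = cratio C f' g' <-> mdvd C (f * g' - f' * g).
Proof.
move=> h h'; have [g0 g'0] := (regular_neq0 h.2, regular_neq0 h'.2).
split.
  move/eqP; rewrite -Quotient.idealrBE => /asboolP[a [b [ab rb Ca]]].
  rewrite rmorphB /= !val_ratio // fracB // => /eqP.
  rewrite eqr_div ?tofrac_eq0 ?mulf_neq0 ?(regular_neq0 rb) //.
  (* The difference of the two fractions is some [a / b] with [C] dividing [a]. Clearing
     denominators shows that [C] divides [b] times the cross difference, and the regular factor [b]
     cancels. *)
  rewrite -!rmorphM tofrac_eq => /eqP e; apply: (rb); rewrite mulrC e mulrC.
  exact: mdvdMl.
move=> Cfg; apply/eqP; rewrite -Quotient.idealrBE; apply/asboolP.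
exists (f * g' - f' * g), (g * g'); split=> //.
- exact: same_degB h.1 h'.1.
- exact: regularM h.2 h'.2.
- by rewrite rmorphB /= !val_ratio // fracB.
Qed.

Lemma cratioP (h : cfun C) : exists fg, good fg.1 fg.2 /\ h = cratio C fg.1 fg.2.
Proof.
rewrite -[h]reprK; move: (repr h) => u.
have /asboolP[f [g [fg rg e]]] : val u \in gen_pred C by exact: valP.
exists (f, g); split=> //; rewrite /cratio; congr (\pi _); apply: val_inj.
by rewrite val_ratio.
Qed.

(** [cratio] depends only on the fraction, so [g] itself need not be regular if the fraction has
    another, good representative. In all remaining cases [cratio_bad] applies: either the default of
    [insubd] or division by zero gives 0. *)
Lemma cratio_good f g f' g' : g != 0 -> good f' g' -> f * g' = f' * g ->
  cratio C f g = cratio C f' g'.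
Proof.
move=> g0 h' e; congr (\pi _); congr insubd.
by apply/eqP; rewrite eqr_div ?tofrac_eq0 ?(regular_neq0 h'.2) // -!rmorphM e.
Qed.

Lemma cratio_bad f g :
  ~ (g != 0 /\ exists f' g', good f' g' /\ f * g' = f' * g) -> cratio C f g = 0.
Proof.
move=> bad; rewrite /cratio -[RHS](rmorph0 \pi_(cfun C)); congr (\pi _).
apply: val_inj; rewrite val_insubd; case: ifP => //= /asboolP[f' [g' [fg' rg' e]]].
have [->|g0] := eqVneq g 0; first by rewrite rmorph0 invr0 mulr0.
case: bad; split=> //; exists f', g'; split=> //; apply/eqP.
rewrite -tofrac_eq !rmorphM -eqr_div ?tofrac_eq0 ?(regular_neq0 rg') //.
exact/eqP.
Qed.

End Equation.

(** * Transport along a projective transformation *)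

Section Transport.
Variable k : fieldType.
Implicit Types (A : 'M[k]_3) (C : cubic k) (Q : pspace k 2).

(* [x] |-> [x A] maps C1 onto C2. *)
Definition carries A C1 C2 : Prop := A \in unitmx /\
  exists2 c, c != 0 & subst A C2 = c *: (C1 : {mpoly k[3]}).

Lemma carries_inv A C1 C2 : carries A C1 C2 -> carries (invmx A) C2 C1.
Proof.
case=> Au [c c0 e]; split; first by rewrite unitmx_inv.
exists c^-1; first by rewrite invr_eq0.
apply: (scalerI c0); rewrite scalerA divff // scale1r -linearZ /= -e.
exact: substK.
Qed.

Lemma carries_mdvd A C1 C2 f :
  carries A C1 C2 -> mdvd C2 f -> mdvd C1 (subst A f).
Proof.
case=> Au [c c0 e] [q ->]; exists (c *: subst A q).
by rewrite rmorphM /= e -scalerAr scalerAl.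
Qed.

Lemma carries_regular A C1 C2 g :
  carries A C1 C2 -> regular_on C2 g -> regular_on C1 (subst A g).
Proof.
move=> AC rg h; have Au := AC.1.
(* Writing [h] as a substituted form moves the divisibility to [C2], where [g] cancels; the result
   is then carried back to [C1]. *)
rewrite -{1}(substVK Au h) -rmorphM => /(carries_mdvd (carries_inv AC)).
by rewrite substK // => /rg /(carries_mdvd AC); rewrite substVK.
Qed.

Lemma carries_good A C1 C2 f g :
  carries A C1 C2 -> good C2 f g -> good C1 (subst A f) (subst A g).
Proof.
move=> AC [fg rg]; split; first exact: subst_same_deg.
exact: carries_regular AC rg.
Qed.

Section Pull.
Variables (A : 'M[k]_3) (C1 C2 : cubic k) (AC : carries A C1 C2).

(* The isomorphism k(C2) -> k(C1) induced by [x] |-> [x A]. The comparison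
   cfun_pullE also covers the junk values of cratio. *)
Definition cfun_pull (h : cfun C2) : cfun C1 :=
  let fg := sval (cid (cratioP h)) in cratio C1 (subst A fg.1) (subst A fg.2).

(** The chosen representative does not matter: two good representatives have a cross difference
    divisible by [C2], which [subst A] turns into a multiple of [C1]. *)
Lemma cfun_pull_good f g : good C2 f g ->
  cfun_pull (cratio C2 f g) = cratio C1 (subst A f) (subst A g).
Proof.
move=> fg; rewrite /cfun_pull; case: cid => -[f' g'] /= [fg' /esym].
move/(cratio_eqP fg' fg) => /(carries_mdvd AC); rewrite rmorphB !rmorphM /=.
by move=> e; apply/cratio_eqP => //; apply: carries_good AC _.
Qed.

Lemma cfun_pullD : {morph cfun_pull : h h' / h + h'}.
Proof.
move=> h h'; have [[f g] /= [fg ->]] := cratioP h.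
have [[f' g'] /= [fg' ->]] := cratioP h'.
rewrite cratioD // !cfun_pull_good //; last exact: goodD.
by rewrite rmorphD !rmorphM cratioD //; apply: carries_good AC _.
Qed.

Lemma cfun_pullM : {morph cfun_pull : h h' / h * h'}.
Proof.
move=> h h'; have [[f g] /= [fg ->]] := cratioP h.
have [[f' g'] /= [fg' ->]] := cratioP h'.
rewrite cratioM // !cfun_pull_good //; last exact: goodM.
by rewrite !rmorphM cratioM //; apply: carries_good AC _.
Qed.

Lemma cfun_pull0 : cfun_pull 0 = 0.
Proof. by apply: (addrI (cfun_pull 0)); rewrite -cfun_pullD !addr0. Qed.

(** Arbitrary [f] and [g] are allowed because [pullback], [cloc] and [cmax] do not require regular
    denominators. If no good representative exists on [C2], none exists on [C1] either, since the
    inverse matrix would carry it back; both sides are then 0. *)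
Lemma cfun_pullE f g :
  cfun_pull (cratio C2 f g) = cratio C1 (subst A f) (subst A g).
Proof.
have Au := AC.1.
have [[g0 [f' [g' [fg' e]]]]|bad] :=
  pselect (g != 0 /\ exists f' g', good C2 f' g' /\ f * g' = f' * g).
  rewrite (cratio_good g0 fg' e) cfun_pull_good //; apply/esym/cratio_good.
  - by rewrite subst_eq0.
  - exact: carries_good AC fg'.
  - by rewrite -!rmorphM e.
rewrite cratio_bad // cfun_pull0 cratio_bad // => -[g0 [f' [g' [fg' e]]]].
apply: bad; split; first by rewrite -(subst_eq0 _ Au).
exists (subst (invmx A) f'), (subst (invmx A) g'); split.
  exact: carries_good (carries_inv AC) fg'.
by apply: (can_inj (substK Au)); rewrite !rmorphM /= !substVK.
Qed.

Lemma cfun_pull_pullback (G : 'rV[{mpoly k[3]}]_2) u :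
  map_mx (subst A) G = G ->
  cfun_pull (pullback C2 G u) = pullback C1 G u.
Proof.
by move=> GA; rewrite /pullback cfun_pullE; congr cratio; rewrite /subst mpcompA GA.
Qed.

End Pull.

Lemma vline_scale n s (v : 'rV[k]_n) : s != 0 -> <[s *: v]>%VS = <[v]>%VS.
Proof.
move=> s0; apply/eqP; rewrite eqEsubv -!memvE memvZ ?memv_line //=.
by rewrite -{1}[v](scalerK s0) memvZ ?memv_line.
Qed.

(** The factor [s] absorbs the arbitrary choice of coordinates made by [hcoord]. *)
Definition moves A Q Q' := exists2 s, s != 0 & hcoord Q' = s *: (hcoord Q *m A).

Lemma moves_inv A Q Q' : A \in unitmx -> moves A Q Q' -> moves (invmx A) Q' Q.
Proof.
move=> Au [s s0 e]; exists s^-1; first by rewrite invr_eq0.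
by rewrite e -scalemxAl mulmxK // scalerA mulVf // scale1r.
Qed.

Lemma fvanish_subst A Q Q' d f : moves A Q Q' -> f \is d.-homog ->
  fvanish (subst A f) Q <-> fvanish f Q'.
Proof.
case=> s s0 e fd; rewrite /fvanish feval_subst e (feval_scale _ _ fd).
split=> [->|/eqP]; first by rewrite mulr0.
by rewrite mulf_eq0 expf_eq0 (negbTE s0) andbF => /eqP.
Qed.

Lemma cfun_pull_cloc A C1 C2 Q Q' (h : cfun C2) :
  carries A C1 C2 ->
  moves A Q Q' -> cloc Q' h -> cloc Q (cfun_pull A C1 h).
Proof.
move=> AC QQ' [f [g [[d [fd gd]] g0 ->]]]; exists (subst A f), (subst A g); split.
- by apply: subst_same_deg; exists d.
- by move/(fvanish_subst QQ' gd).
- exact: cfun_pullE.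
Qed.

Lemma cfun_pull_cmax A C1 C2 Q Q' (h : cfun C2) :
  carries A C1 C2 ->
  moves A Q Q' -> cmax Q' h -> cmax Q (cfun_pull A C1 h).
Proof.
move=> AC QQ' [f [g [[d [fd gd]] g0 f0 ->]]].
exists (subst A f), (subst A g); split.
- by apply: subst_same_deg; exists d.
- by move/(fvanish_subst QQ' gd).
- exact/(fvanish_subst QQ' fd).
- exact: cfun_pullE.
Qed.

Lemma cfun_pull_pow A C1 C2 Q Q' e (h : cfun C2) :
  carries A C1 C2 ->
  moves A Q Q' -> ideal_pow (@cloc k C2 Q') (@cmax k C2 Q') e h ->
  ideal_pow (@cloc k C1 Q) (@cmax k C1 Q) e (cfun_pull A C1 h).
Proof.
move=> AC QQ'; elim: e h => [|e IH] h /=; first exact: cfun_pull_cloc.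
case=> r [rP ->].
exists [seq (cfun_pull A C1 ab.1, cfun_pull A C1 ab.2) | ab <- r]; split.
  move=> _ /mapP[ab /rP[a b] ->] /=; split; last exact: IH.
  exact: cfun_pull_cmax a.
rewrite big_map (big_morph _ (cfun_pullD AC) (cfun_pull0 AC)).
by apply: eq_bigr => ab _; rewrite cfun_pullM.
Qed.

(** * Invariance of ramification indices and values of the projection *)

Section Ramification.
Variables (A : 'M[k]_3) (C1 C2 : cubic k) (M : 'M[k]_(3, 2)).
Hypotheses (AC : carries A C1 C2) (AM : A *m M = M).

Let AVM : invmx A *m M = M.
Proof. by rewrite -{1}AM mulKmx // AC.1. Qed.

(** Membership in the power [e] reaches [C2] by pulling back along the inverse matrix.
    Non-membership in the next power is the contrapositive of pulling back along [A]. *)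
Lemma cval_pull Q Q' u e : moves A Q Q' ->
  cval Q (pullback C1 (linmap M) u) e -> cval Q' (pullback C2 (linmap M) u) e.
Proof.
move=> QQ' [ine nine]; have Au := AC.1; have AC' := carries_inv AC; split.
  rewrite -(cfun_pull_pullback AC') ?linmap_comp ?AVM //.
  exact: cfun_pull_pow (moves_inv Au QQ') _.
move=> /(cfun_pull_pow AC QQ'); rewrite cfun_pull_pullback ?linmap_comp ?AM //.
Qed.

Lemma ratmap_value_pull Q Q' y : moves A Q Q' ->
  ratmap_value C1 (linmap M) Q y -> ratmap_value C2 (linmap M) Q' y.
Proof.
move=> QQ' [H [[[d Hd] [i0 Hr]] HM yE]]; have Au := AC.1.
(* The representative that is nonzero at [Q] is composed with the inverse transformation. It still
   represents the projection because the inverse matrix fixes [M]. *)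
have AC' := carries_inv AC; exists (map_mx (subst (invmx A)) H); split.
- split; first by exists d => i; rewrite mxE; apply: subst_homog.
  by exists i0; rewrite mxE; apply: carries_regular AC' Hr.
- have sM i : subst (invmx A) (linmap M 0 i) = linmap M 0 i.
    by rewrite -[in RHS]AVM -linmap_comp [RHS]mxE.
  move=> i j; have /(carries_mdvd AC') := HM i j.
  by rewrite rmorphB !rmorphM /= !sM 2![map_mx _ H _ _]mxE.
rewrite yE; case: (moves_inv Au QQ') => s s0 e.
(* The entries of [H] have common degree [d], so the change of coordinates by [s] only rescales the
   value vector. *)
suff -> : map_mx (feval (hcoord Q)) H =
    s ^+ d *: map_mx (feval (hcoord Q')) (map_mx (subst (invmx A)) H).
  exact/vline_scale/expf_neq0.
by apply/rowP => i; rewrite !mxE feval_subst e (feval_scale _ _ (Hd i)).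
Qed.

End Ramification.
End Transport.

(** * Linear algebra of projections from a point *)

Section Points.
Variable k : fieldType.
Implicit Types (P Q : pspace k 2).

Lemma hcoord_neq0 n (Q : pspace k n) : hcoord Q != 0.
Proof.
rewrite vpick0; apply/eqP => Q0; case: Q Q0 => U /= U1 U0.
by move: U1; rewrite U0 dimv0.
Qed.

Lemma pspace_line n (Q : pspace k n) : val Q = <[hcoord Q]>%VS.
Proof.
apply/esym/eqP; rewrite eqEdim -memvE memv_pick dim_vline hcoord_neq0.
by rewrite (eqP (valP Q)).
Qed.

Lemma moves_exists (A : 'M[k]_3) Q :
  A \in unitmx -> exists Q', moves A Q Q'.
Proof.
move=> Au; set w := hcoord Q *m A.
have w0 : w != 0.
  apply: contraNneq (hcoord_neq0 Q) => w0.
  by rewrite -(mulmxK Au (hcoord Q)) -/w w0 mul0mx.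
have w1 : \dim <[w]> == 1%N by rewrite dim_vline w0.
exists (exist _ <[w]>%VS w1); have := hcoord_neq0 (exist _ <[w]>%VS w1).
have /vlineP[s e] : hcoord (exist _ <[w]>%VS w1) \in <[w]>%VS.
  exact: memv_pick.
by rewrite e scaler_eq0 negb_or => /andP[s0 _]; exists s.
Qed.

Section Projection.
Variables (P : pspace k 2) (M : 'M[k]_(3, 2)).
Hypothesis hM : projection_from P M.

Lemma projection_center Q : hcoord Q *m M = 0 -> Q = P.
Proof.
move=> /eqP; rewrite hM => QP; apply: val_inj; apply/eqP.
by rewrite eqEdim {1}pspace_line -memvE QP; rewrite (eqP (valP P)) (eqP (valP Q)).
Qed.

(** The kernel of [M] is the line [P], so rank-nullity gives [M] rank 2. *)
Lemma projection_section : exists B : 'M_(2, 3), B *m M = 1%:M.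
Proof.
apply/row_fullP; rewrite /row_full eqn_leq rank_leq_col /=.
have kerP : (kermx M <= hcoord P)%MS.
  apply/row_subP => i; have /sub_kermxP/eqP := row_sub i (kermx M).
  by rewrite hM pspace_line => /vlineP[s ->]; apply: scalemx_sub.
have := leq_trans (mxrankS kerP) (rank_leq_row _).
by rewrite mxrank_ker leq_subLR addn1.
Qed.

(** The identity says that [v N] and [v M] are proportional for each [v]. Polarization against the
    rows of a section makes the factor independent of [v]. *)
Lemma projection_parallel (N : 'M[k]_(3, 2)) :
  (forall v : 'rV_3, (v *m N) 0 0 * (v *m M) 0 1 = (v *m N) 0 1 * (v *m M) 0 0) ->
  exists s, N = s *: M.
Proof.
move=> NM; have [B BM] := projection_section.
have rowBM i j : (row i B *m M) 0 j = (i == j)%:R by rewrite -row_mul BM !mxE.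
have NMD v w := NM (v + w).
pose n i j := (row i B *m N) 0 j.
have n01 : n 0 1 = 0 by have := NM (row 0 B); rewrite !rowBM /= mulr0 mulr1.
have n10 : n 1 0 = 0 by have := NM (row 1 B); rewrite !rowBM /= mulr0 mulr1.
have n00 : n 0 0 = n 1 1.
  have := NMD (row 0 B) (row 1 B); rewrite !mulmxDl ![(_ + _ : 'rV_2) _ _]mxE.
  by rewrite !rowBM /= -!/(n _ _) n01 n10 !add0r !addr0 !mulr1.
exists (n 0 0); apply/matrixP => i j.
pose v : 'rV[k]_3 := delta_mx 0 i.
have vE (X : 'M[k]_(3, 2)) l : (v *m X) 0 l = X i l by rewrite -rowE mxE.
(* Cancelling the identity at [v] from the one at [v] plus a row of [B] leaves a linear relation:
   row 1 determines column 0 of [N], and row 0 determines column 1. *)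
have := NMD v (row 0 B); have := NMD v (row 1 B).
rewrite !mulmxDl ![(_ + _ : 'rV_2) _ _]mxE !rowBM /= -!/(n _ _) n01 n10 -n00.
rewrite !addr0 !mulrDl !mulrDr (NM v) !mulr1 => /addrI e1 /addrI e0.
have [->|->] : j = 0 \/ j = 1.
- by case: j => -[|[|//]] ?; [left | right]; apply: val_inj.
- by rewrite [RHS]mxE -(vE N) e1 vE.
- by rewrite [RHS]mxE -(vE N) -e0 vE.
Qed.

End Projection.

(** [SG1] provides its own coordinates on the target line, which must be compared with the given
    ones. The vector [v - v M' B] is killed by [M'], so it lies on the line [P] and is killed by [M]
    too; hence [D = B M] works. *)
Lemma projection_factor P (M M' : 'M[k]_(3, 2)) :
  projection_from P M -> projection_from P M' -> exists D, M = M' *m D.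
Proof.
move=> hM hM'; have [B BM'] := projection_section hM'.
exists (B *m M); apply/row_matrixP => i; rewrite mulmxA !row_mul.
set v := row i M' *m B.
have : (row i 1%:M - row i 1%:M *m M' *m B) *m M' = 0.
  by rewrite mulmxBl -(mulmxA _ B) BM' mulmx1 subrr.
move/eqP; rewrite hM' -hM mulmxBl subr_eq0 -!row_mul !mul1mx => /eqP.
by rewrite /v -!row_mul.
Qed.

End Points.

(** * From a birational map to the linear map that induces it *)

Section FirstKind.
Variables (k : fieldType) (C1 C2 : cubic k).
Variable phi : 'rV[{mpoly k[3]}]_3.

(** The rows [G 0 i *: H] and [H 0 i *: G] are congruent modulo [C1]. Substituting both into [f] and
    extracting the factors by homogeneity gives the claim. *)
Lemma mdvd_ratmap_eq n (G H : 'rV[{mpoly k[3]}]_n.+1) d f i :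
  ratmap_eq C1 G H -> f \is d.-homog ->
  mdvd C1 (G 0 i ^+ d * mpcomp H f - H 0 i ^+ d * mpcomp G f).
Proof.
move=> GH fd; rewrite -!(mpcomp_scale _ _ fd); apply: mdvd_mpcomp => j.
by rewrite !mxE [H 0 i * _]mulrC; apply: GH.
Qed.

Lemma carries_linear A : A \in unitmx -> ratmap_into C1 C2 phi ->
  ratmap_eq C1 phi (linmap A) -> carries A C1 C2.
Proof.
move=> Au [[_ [i ri]] C2phi] phiA; split=> //.
apply: mdvd_cubic; first exact: subst_homog (cubic_homog C2).
  by rewrite subst_eq0 // cubic_neq0.
(* Modulo [C1], [phi 0 i ^+ 3] times [subst A C2] is a multiple of [mpcomp phi C2], hence zero.
   Cancelling the regular cube leaves a cubic form divisible by [C1]. *)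
have r3 : regular_on C1 (phi 0 i ^+ 3) by do 2?apply: regularM.
apply: (r3); rewrite -[X in mdvd _ X](subrK (linmap A 0 i ^+ 3 * mpcomp phi C2)).
apply: mdvdD; last exact: mdvdMl.
exact: mdvd_ratmap_eq phiA (cubic_homog C2).
Qed.

Lemma linear_over_line A (M : 'M[k]_(3, 2)) : is_ratmap C1 phi ->
  ratmap_eq C1 phi (linmap A) ->
  ratmap_eq C1 (ratmap_comp (linmap M) phi) (linmap M) ->
  forall v : 'rV_3, (v *m (A *m M)) 0 0 * (v *m M) 0 1 =
                    (v *m (A *m M)) 0 1 * (v *m M) 0 0.
Proof.
move=> [_ [l rl]] phiA phiM v; pose m := linmap M 0.
have m1 j : m j \is 1.-homog by apply: linmap_homog.
suff /eqP : subst A (m 0) * m 1 - subst A (m 1) * m 0 = 0.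
  rewrite subr_eq0 => /eqP/(congr1 (feval v)).
  have fm w j : feval w (m j) = (w *m M) 0 j.
    by rewrite -feval_linmap [RHS]mxE.
  rewrite /feval !rmorphM /= -!/(feval _ _) !feval_subst !fm.
  by rewrite !mulmxA.
apply: (@mdvd_small _ C1 2) => //.
  by apply: rpredB; apply: (@dhomogM _ _ _ 1 _ 1) => //; apply: subst_homog.
(* Multiplying by the regular coordinate [phi 0 l] allows [A] to be replaced by [phi] modulo [C1],
   where [phiM] applies. *)
apply: (rl); pose L := linmap A 0 l.
have cong j : mdvd C1 (phi 0 l * subst A (m j) - L * mpcomp phi (m j)).
  exact: mdvd_ratmap_eq l phiA (m1 j).
have mM : mdvd C1 (mpcomp phi (m 0) * m 1 - mpcomp phi (m 1) * m 0).
  by have := phiM 0 1; rewrite 2![ratmap_comp _ _ _ _]mxE.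
rewrite (_ : phi 0 l * _ =
  m 1 * (phi 0 l * subst A (m 0) - L * mpcomp phi (m 0))
  - m 0 * (phi 0 l * subst A (m 1) - L * mpcomp phi (m 1))
  + L * (mpcomp phi (m 0) * m 1 - mpcomp phi (m 1) * m 0)); last by ring.
by apply: mdvdD; [apply: mdvdB|]; apply: mdvdMl.
Qed.

End FirstKind.

(** * Comparison of the ramification images *)

Section Main.
Variables (k : fieldType) (P : pspace k 2) (M : 'M[k]_(3, 2)).
Hypothesis hM : projection_from P M.

Lemma SG1_linear C1 C2 : SG1 C1 C2 P ->
  exists A, A *m M = M /\ carries A C1 C2.
Proof.
move=> [M' [phi [hM' [bir _] _ phiM [A Au phiA]]]].
have [s AM'] := projection_parallel hM' (linear_over_line bir.1 phiA phiM).
have [D MD] := projection_factor hM hM'.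
have AM : A *m M = s *: M by rewrite MD mulmxA AM' scalemxAl.
have s0 : s != 0.
  (* If [s] were 0, then [A M = 0], so [M = 0] by invertibility of [A], contradicting [B M = 1]. *)
  apply/eqP => s0; have [B BM] := projection_section hM; move: BM.
  rewrite -[M](mulKmx Au) AM s0 scale0r !mulmx0 => /matrixP/(_ 0 0)/eqP.
  by rewrite !mxE eq_sym oner_eq0.
exists (s^-1 *: A); split; first by rewrite -scalemxAl AM scalerA mulVf // scale1r.
apply: carries_linear bir _; first by rewrite unitmxZ ?unitfE ?invr_eq0.
(* The scalar factors out of the cross products, so the rescaled matrix still represents [phi]. *)
move=> i j; rewrite linmap_scale ![(_ *: linmap A) _ _]mxE mulrCA [X in _ - X]mulrCA -mulrBr.
exact: mdvdMl.
Qed.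

Lemma ram_image_sub A C1 C2 : A *m M = M -> carries A C1 C2 ->
  ratmap_image C1 (linmap M) (ram_points C1 (linmap M) `\ P) `<=`
  ratmap_image C2 (linmap M) (ram_points C2 (linmap M) `\ P).
Proof.
move=> AM AC y [Q [[CQ [y' [t [e [Qy' ty' te e1]]]]] QP] Qy].
have [Q' QQ'] := moves_exists Q AC.1.
exists Q'; last exact: (ratmap_value_pull AC AM QQ' Qy).
split; last first.
  (* [P] is the only point killed by [M]. Since [A M = M], the coordinates of [Q] and [Q'] have
     proportional images under [M], so [Q' = P] forces [Q = P]. *)
  move=> Q'P; apply: QP; apply: (projection_center hM); have := QQ'.
  case=> s s0 e'; apply: (scalerI s0); rewrite scaler0 -AM mulmxA scalemxAl -e' Q'P.
  by apply/eqP; rewrite hM memv_pick.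
split.
  apply/(fvanish_subst QQ' (cubic_homog C2)); have [_ [c _ ->]] := AC.
  by rewrite /fvanish /feval mevalZ [X in _ * X]CQ mulr0.
exists y', t, e; split=> //; first exact: (ratmap_value_pull AC AM QQ' Qy').
exact: (cval_pull AC AM QQ' te).
Qed.

End Main.

Theorem proposition15 (k : closedFieldType) (hk : [pchar k] =i pred0)
  (C1 C2 : cubic k) (hC1 : nonsingular C1) (hC2 : nonsingular C2)
  (hC : cpoints C1 <> cpoints C2)
  (P : pspace k 2) (hP : (cpoints C1 `&` cpoints C2) P)
  (M : 'M[k]_(3, 2)) (hM : projection_from P M)
  (hSG : SG1_in C1 C2 P) :
  ratmap_image C1 (linmap M) (ram_points C1 (linmap M) `\ P) =
  ratmap_image C2 (linmap M) (ram_points C2 (linmap M) `\ P).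
Proof.
have [A [AM AC]] := SG1_linear hM hSG.2.
apply/seteqP; split; first exact: (ram_image_sub hM AM AC).
(* The inverse matrix also fixes [M], so the same inclusion applies with the curves exchanged. *)
apply: (ram_image_sub hM _ (carries_inv AC)).
by rewrite -{1}AM mulKmx // AC.1.
Qed.
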